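(* For every integer $d \geq 1$ there exists a constant $c_2(d)>0$, with $c_2(d)=O(d)$ as $d\to\infty$, such that the topological Pach number satisfies $\tau(d,n) \leq c_2(d)\, n^{1/d}$ for all integers $n \geq (2d)^d$.
   Context: Simplicial complexes are identified with their geometric realizations; for an abstract simplex $\{v_0,\ldots,v_k\}$ write $\langle v_0,\ldots,v_k\rangle$ for its geometric realization. Let $V_1,\ldots,V_{d+1}$ be pairwise disjoint sets, each of size $n$, and let $V_1*\cdots*V_{d+1}$ be their join, i.e. the simplicial complex $\{\sigma \subset \bigcup_i V_i : |\sigma\cap V_i|\le 1 \text{ for all } i\}$. For a continuous map $f: V_1*\cdots*V_{d+1} \to \mathbb{R}^d$, let $\tau(f)$ be the maximal $m$ such that there exist $m$-element subsets $Z_1\subset V_1,\ldots,Z_{d+1}\subset V_{d+1}$ with $\bigcap_{z_1\in Z_1,\ldots,z_{d+1}\in Z_{d+1}} f(\langle z_1,\ldots,z_{d+1}\rangle) \neq \emptyset$. The topological Pach number $\tau(d,n)$ is the minimum of $\tau(f)$ over all continuous maps $f: V_1*\cdots*V_{d+1}\to\mathbb{R}^d$. *)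

(* Defs.v *)
From HB Require Import structures.
From mathcomp Require Import all_boot all_order all_algebra.
From mathcomp Require Import all_classical all_reals all_analysis.
Set Implicit Arguments.
Unset Strict Implicit.
Unset Printing Implicit Defensive.
Import Order.TTheory GRing.Theory Num.Theory.
Import numFieldNormedType.Exports.
Local Open Scope classical_set_scope.
Local Open Scope ring_scope.

(* The join V_0 * ... * V_(k-1) of the vertex sets V_i, regarded as discrete
   complexes. It contains the empty simplex, whose realization is empty. *)
Definition join (T : finType) (k : nat) (V : 'I_k -> {set T}) : {set {set T}} :=
  [set s : {set T} |
    (s \subset (\bigcup_i V i)%SET) && [forall i, #|s :&: V i| <= 1]%N]%SET.

(* Realizations live in R^T, in barycentric coordinates. As T is finite, the
   product topology of R^T induces the usual topology on every complex. *)
Definition gsimplex (R : realType) (T : finType) (s : {set T}) :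
    set {ptws T -> R} :=
  [set x | [/\ forall v, 0 <= x v, \sum_v x v = 1 &
               forall v, v \notin s -> x v = 0]].

Definition realization (R : realType) (T : finType) (K : {set {set T}}) :
    set {ptws T -> R} :=
  \bigcup_(s in [set` K]) gsimplex s.

Definition overlap (R : realType) (d : nat) (T : finType)
    (V : 'I_d.+1 -> {set T}) (f : {ptws T -> R} -> 'rV[R]_d) (m : nat) : Prop :=
  exists Z : 'I_d.+1 -> {set T},
    (forall i, Z i \subset V i /\ #|Z i| = m) /\
    (\bigcap_(z in [set z : 'I_d.+1 -> T | forall i, z i \in Z i])
      (f @` gsimplex [set z i | i in 'I_d.+1]%SET)) !=set0.

(* Since #|Z i| = m forces m <= #|V i|, bounding m by #|V 0| loses nothing;
   the case m = 0 always satisfies [overlap]. *)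
Definition tau (R : realType) (d : nat) (T : finType)
    (V : 'I_d.+1 -> {set T}) (f : {ptws T -> R} -> 'rV[R]_d) : nat :=
  \max_(m < #|V ord0|.+1 | `[< overlap V f m >]) m.

(* Up to isomorphism the join depends only on the sizes of the parts, so the
   Pach number is computed on the disjoint sets {i} x {0, ..., n - 1}. *)
Definition parts (k n : nat) (i : 'I_k) : {set 'I_k * 'I_n} :=
  [set v | v.1 == i]%SET.

(* A continuous map on the realization is represented by any extension to R^T
   whose restriction is continuous; [tau] only sees values on the complex. *)
Definition pach_value (R : realType) (d n t : nat) : Prop :=
  exists f : {ptws ('I_d.+1 * 'I_n)%type -> R} -> 'rV[R]_d,
    {within realization (join (@parts d.+1 n)), continuous f} /\
    tau (@parts d.+1 n) f = t.

Lemma pach_value_ex (R : realType) (d n : nat) :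
  exists t, `[< pach_value R d n t >].
Proof.
exists (tau (@parts d.+1 n) (fun _ : {ptws _ -> R} => 0 : 'rV[R]_d)).
apply/asboolP; eexists; split; last reflexivity.
by move=> x; exact: cvg_cst.
Qed.

Definition pach_number (R : realType) (d n : nat) : nat :=
  ex_minn (pach_value_ex R d n).

(* Main.v *)
Require Import Defs.
From mathcomp Require Import all_boot all_order all_algebra all_field.
From mathcomp Require Import all_classical all_reals all_analysis.
From mathcomp Require Import zify.
Set Implicit Arguments.
Unset Strict Implicit.
Unset Printing Implicit Defensive.
Import Order.TTheory GRing.Theory Num.Theory.
Import numFieldNormedType.Exports.
Local Open Scope ring_scope.

(** Identify the vertices of each V_i with points of K^d, where K is a finite
    field with q elements and q is about n^(1/d). The map f sends the
    barycenter of a face A to a generic point of R^d attached to the affine span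
    of A, and each simplex of the barycentric subdivision into the convex hull
    of the images of its vertices. If all vertices of a simplex
    lie on a hyperplane h, then its image is covered by a (d-1)-simplex whose
    vertices are attached to a flag of flats inside h. By the second moment
    method, a set of m points misses at most a fraction q/m of the hyperplanes,
    so when m > 2(d+1)q more than half of the hyperplanes meet all Z_i. As a
    point lies on a fraction 1/q of them and q >= 2d, one can greedily choose
    d+1 such hyperplanes with pairwise disjoint flags. A common point u of the
    images of the simplices then lies in d+1 simplices of dimension d-1 with
    disjoint generic vertex sets, which is impossible in R^d. *)

(** * General position in real space *)

(** A coordinate-free substitute for polynomial functions on [V]: restrictions to lines are all that
    finding common nonzeros requires. *)
Definition poly_on_lines (R : nzRingType) (V : lmodType R) (Q : V -> R) :=
  forall v w, exists p : {poly R}, forall t, p.[t] = Q (v + t *: w).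

Lemma exists_nonroot (R : numDomainType) (p : {poly R}) :
  p != 0 -> exists t, ~~ root p t.
Proof.
move=> p0; pose s : seq R := [seq i%:R | i <- iota 0 (size p)].
have us : uniq s.
  by rewrite map_inj_uniq ?iota_uniq // => i j /eqP; rewrite eqr_nat => /eqP.
have [/(max_poly_roots p0)/(_ us)|/allPn[t _ pt]] := boolP (all (root p) s).
  by rewrite size_map size_iota ltnn.
by exists t.
Qed.

Lemma poly_on_lines_prod (R : comNzRingType) (V : lmodType R) (I : Type)
    (s : seq I) (Q : I -> V -> R) :
  (forall i, poly_on_lines (Q i)) ->
  poly_on_lines (fun v => \prod_(i <- s) Q i v).
Proof.
move=> Qpoly v w; elim: s => [|i s [p pP]].
  by exists 1 => t; rewrite hornerC big_nil.
have [r rP] := Qpoly i v w.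
by exists (r * p) => t; rewrite hornerM rP pP big_cons.
Qed.

(** If the product of the earlier functions is nonzero at [v] and the next function is nonzero at
    [w], both restrict to nonzero polynomials on the line through [v] and [w], and their product has
    a nonroot there. *)
Lemma common_nonzero (R : numDomainType) (V : lmodType R) (I : finType)
    (Q : I -> V -> R) :
  (forall i, poly_on_lines (Q i)) -> (forall i, exists v, Q i v != 0) ->
  exists v, forall i, Q i v != 0.
Proof.
move=> Qpoly Q0.
suff [v vP] : exists v, \prod_(i <- enum I) Q i v != 0.
  exists v => i; move: vP; rewrite prodf_seq_neq0 => /allP/(_ i).
  by rewrite mem_enum; apply.
elim: (enum I) => [|i s [v v0]]; first by exists 0; rewrite big_nil oner_eq0.
have [w w0] := Q0 i.
have [p pP] := poly_on_lines_prod s Qpoly v (w - v).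
have [r rP] := Qpoly i v (w - v).
have [|t] := @exists_nonroot _ (r * p).
  rewrite mulf_neq0 //; apply/eqP => e.
    by have := rP 1; rewrite scale1r addrC subrK e horner0 => /esym/eqP; apply/negP.
  by have := pP 0; rewrite scale0r addr0 e horner0 => /esym/eqP; apply/negP.
by rewrite /root hornerM rP pP => tP; exists (v + t *: (w - v)); rewrite big_cons.
Qed.

(* The entries of row [i] are the signed maximal minors of the d vectors
   [v (F i k)], that is, the coefficients of the hyperplane they span. *)
Definition normals (R : comNzRingType) (d : nat) (T : Type)
    (F : 'I_d.+1 -> 'I_d -> T) (v : T -> 'I_d.+1 -> R) : 'M[R]_d.+1 :=
  \matrix_(i, j) ((-1) ^+ j * \det (\matrix_(k, l) v (F i k) (lift j l))).

Lemma map_normals (R S : comNzRingType) (g : {rmorphism R -> S}) (d : nat)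
    (T : Type) (F : 'I_d.+1 -> 'I_d -> T) (v : T -> 'I_d.+1 -> R) :
  map_mx g (normals F v) = normals F (fun x j => g (v x j)).
Proof.
apply/matrixP => i j; rewrite !mxE rmorphM rmorphXn rmorphN rmorph1 /=.
by rewrite -det_map_mx; congr (_ * \det _); apply/matrixP => k l; rewrite !mxE.
Qed.

Lemma poly_on_lines_det_normals (R : comNzRingType) (d : nat) (T : finType)
    (F : 'I_d.+1 -> 'I_d -> T) :
  poly_on_lines (fun v : {ffun T -> 'rV[R]_d.+1} =>
    \det (normals F (fun x j => v x 0 j))).
Proof.
move=> v w.
exists (\det (normals F (fun x j => (v x 0 j)%:P + 'X * (w x 0 j)%:P))) => t.
rewrite -[LHS]/(horner_eval t _) -det_map_mx map_normals; congr (\det _).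
apply/matrixP => i j; rewrite !mxE; congr (_ * \det _).
apply/matrixP => k l; rewrite [LHS]mxE [RHS]mxE !ffunE !mxE /= /horner_eval.
by rewrite hornerD hornerM hornerX !hornerC.
Qed.

(** Since [F] never repeats a vertex, the vectors can be prescribed independently: giving family [i]
    all standard basis vectors except the [i]-th makes the matrix diagonal with entries 1 and -1. *)
Lemma det_normals_neq0 (R : comNzRingType) (d : nat) (T : finType)
    (F : 'I_d.+1 -> 'I_d -> T) :
  injective (fun p => F p.1 p.2) ->
  exists v : {ffun T -> 'rV[R]_d.+1}, \det (normals F (fun x j => v x 0 j)) != 0.
Proof.
move=> Finj.
pose v : {ffun T -> 'rV[R]_d.+1} := [ffun x =>
  if [pick p | F p.1 p.2 == x] is Some p then delta_mx 0 (lift p.1 p.2) else 0].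
have vF i k : v (F i k) = delta_mx 0 (lift i k).
  rewrite ffunE; case: pickP => [[i' k'] /eqP/= /(Finj (i', k') (i, k))[-> ->]//|].
  by move=> /(_ (i, k)); rewrite eqxx.
exists v; suff -> : normals F (fun x j => v x 0 j) = diag_mx (\row_j (-1) ^+ j).
  rewrite det_diag (eq_bigr (fun j : 'I__ => (-1) ^+ j)); last by move=> j _; rewrite mxE.
  by rewrite -expr_sum signr_eq0.
apply/matrixP => i j; rewrite !mxE.
have [->|ij] := eqVneq i j.
  rewrite mulr1n -[RHS]mulr1; congr (_ * _); rewrite -[RHS](det1 _ d); congr (\det _).
  by apply/matrixP => k l; rewrite !mxE vF !mxE eqxx /= (inj_eq lift_inj) eq_sym.
rewrite mulr0n; case: (unliftP i j) => [k jk|ji]; last by rewrite ji eqxx in ij.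
rewrite (expand_det_row _ k) big1 ?mulr0 // => l _.
rewrite !mxE vF !mxE eqxx /= -jk eq_sym (negPf (neq_lift _ _)) mul0r //.
Qed.

(** Row [i] paired with [u] is the determinant of [u] stacked on family [i], which vanishes as [u]
    lies in the span of that family. So the invertible matrix of normals kills [u]. *)
Lemma common_hyperplane_point_eq0 (R : fieldType) (d : nat) (T : finType)
    (F : 'I_d.+1 -> 'I_d -> T) (v : T -> 'rV[R]_d.+1) (u : 'rV[R]_d.+1)
    (a : 'I_d.+1 -> 'I_d -> R) :
  \det (normals F (fun x j => v x 0 j)) != 0 ->
  (forall i, u = \sum_k a i k *: v (F i k)) -> u = 0.
Proof.
move=> detN uE; apply/eqP/negPn/negP => u0; case/negP: detN.
rewrite -det_tr; apply/det0P; exists u => //; apply/rowP => i; rewrite !mxE.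
pose A : 'M[R]_(1 + d) := col_mx u (\matrix_k v (F i k)).
transitivity (\det A).
  rewrite (expand_det_row A 0); apply: eq_bigr => j _; rewrite !mxE /cofactor.
  case: splitP => // j0 _; rewrite ord1; congr (_ * (_ * \det _)).
  apply/matrixP => k l; rewrite !mxE.
  case: splitP => [[[]]//|k' /= e]; rewrite mxE.
  by have -> : k = k' by apply/val_inj; case: e.
apply/eqP/det0P; exists (row_mx 1 (- \row_k a i k) : 'rV_(1 + d)).
  apply/eqP => /rowP/(_ 0); rewrite !mxE; case: splitP => // j _.
  by rewrite ord1 !mxE eqxx => /eqP; rewrite oner_eq0.
rewrite mul_row_col mul1mx mulNmx; apply/eqP; rewrite subr_eq0; apply/eqP.
rewrite [LHS](uE i) mulmx_sum_row; apply: eq_bigr => k _.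
by rewrite mxE rowK.
Qed.

(** Vectors with nonzero coordinate 0 and nonzero determinants for all injective [F] exist, these
    being finitely many polynomial conditions. Dividing by coordinate 0 gives the points. *)
Lemma affine_general_position (R : numFieldType) (d : nat) (T : finType) :
  exists w : T -> 'rV[R]_d, forall (F : 'I_d.+1 -> 'I_d -> T),
    injective (fun p => F p.1 p.2) ->
    forall (u : 'rV[R]_d) (a : 'I_d.+1 -> 'I_d -> R),
    (forall i, \sum_k a i k = 1) ->
    ~ (forall i, u = \sum_k a i k *: w (F i k)).
Proof.
pose J := {ffun 'I_d.+1 * 'I_d -> T}.
pose cur (F : J) i k := F (i, k).
pose Q (j : T + J) (v : {ffun T -> 'rV[R]_d.+1}) := match j with
  | inl x => v x 0 0
  | inr F => if injectiveb F then \det (normals (cur F) (fun x j => v x 0 j)) else 1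
  end.
have [||v vP] := @common_nonzero R _ _ Q.
- move=> [x|F] v w /=.
    by exists ((v x 0 0)%:P + 'X * (w x 0 0)%:P) => t; rewrite !hornerE !ffunE !mxE.
  case: (injectiveb F); first by exact: poly_on_lines_det_normals.
  by exists 1%:P => t; rewrite hornerC.
- move=> [x|F] /=.
    by exists [ffun=> const_mx 1]; rewrite ffunE mxE oner_eq0.
  case: injectiveP => [Finj|_]; last by exists 0; rewrite oner_eq0.
  by apply: det_normals_neq0 => -[i k] [i' k'] /= /Finj.
exists (fun x => \row_j (v x 0 (lift 0 j) / v x 0 0)) => F Finj u a a1 uE.
have Fdet : \det (normals F (fun x j => v x 0 j)) != 0.
  have := vP (inr [ffun p => F p.1 p.2]); rewrite /Q /=.
  rewrite ifT; last by apply/injectiveP => p p'; rewrite !ffunE => /Finj.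
  congr (\det _ != 0); apply/matrixP => i j; rewrite !mxE; congr (_ * \det _).
  by apply/matrixP => k l; rewrite !mxE /cur ffunE.
(* Homogenize: [u'] has coordinate 0 equal to 1, so it is nonzero, yet it would lie in all the
   spans. *)
pose u' : 'rV[R]_d.+1 := \row_j oapp (u 0) 1 (unlift 0 j).
have u'E i : u' = \sum_k (a i k / v (F i k) 0 0) *: v (F i k).
  apply/rowP => j; rewrite mxE summxE; case: unliftP => [l ->|->] /=.
    rewrite {1}(uE i) summxE; apply: eq_bigr => k _; rewrite !mxE.
    by rewrite mulrCA mulrC.
  rewrite -(a1 i); apply: eq_bigr => k _; rewrite mxE mulfVK //.
  exact: (vP (inl (F i k))).
have /rowP/(_ 0) := common_hyperplane_point_eq0 Fdet u'E.
by rewrite !mxE unlift_none /= => /eqP; rewrite oner_eq0.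
Qed.

(** * Counting incidences over a finite field *)

(** The translations [add t] permute the level sets of [g] in [B] transitively, so all of them have
    the same size. *)
Lemma card_level_set (K : finFieldType) (V : finType) (add : K -> V -> V)
    (B : {set V}) (g : V -> K) :
  (forall t, cancel (add t) (add (- t))) ->
  (forall t h, (add t h \in B) = (h \in B)) ->
  (forall t h, g (add t h) = g h + t) ->
  forall y, (#|K| * #|[set h in B | g h == y]| = #|B|)%N.
Proof.
move=> addK addB gadd y.
have addNK t : cancel (add (- t)) (add t).
  by move=> h; rewrite -{1}[t]opprK addK.
rewrite -[RHS]sum1_card (partition_big g predT) //=.
rewrite (eq_bigr (fun=> #|[set h in B | g h == y]|)); last first.
  move=> t _; rewrite sum1dep_card.
  rewrite -(card_imset _ (can_inj (addK (y - t)))).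
  apply: eq_card => h; apply/imsetP/idP => [[h' + ->]|].
    by rewrite !inE addB gadd => /andP[-> /eqP->]; rewrite addrC subrK eqxx.
  rewrite inE => /andP[hB /eqP gh]; exists (add (- (y - t)) h); last by rewrite addNK.
  by rewrite inE addB hB gadd gh opprB addrC subrK eqxx.
by rewrite sum_nat_const.
Qed.

Section Incidence.
Variables (K : finFieldType) (d : nat).
Implicit Types (p : 'rV[K]_d.+1) (h : 'cV[K]_d.+1).

(* The point [p] lies on the graph of the affine function
   [h_0 + h_1 p_1 + ... + h_d p_d] if its value is the coordinate [p_0]. *)
Definition lift_pt p : 'rV[K]_d.+1 := \row_j if j == 0 then 1 else p 0 j.
Definition on_plane p h := (lift_pt p *m h) 0 0 == p 0 0.

Lemma card_on_plane p : (#|K| * #|[set h | on_plane p h]| = #|{: 'cV[K]_d.+1}|)%N.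
Proof.
rewrite -[RHS]cardsT -(@card_level_set _ _ (fun t h => h + t *: delta_mx 0 0)
  [set: 'cV[K]_d.+1] (fun h => (lift_pt p *m h) 0 0) _ _ _ (p 0 0)).
- by congr (_ * _)%N; apply: eq_card => h; rewrite !inE.
- by move=> t h; rewrite scaleNr addrK.
- by move=> t h; rewrite !inE.
move=> t h; rewrite mulmxDr -scalemxAr -colE [LHS]mxE; congr (_ + _).
by rewrite !mxE eqxx mulr1.
Qed.

(** Points that differ only in coordinate 0 share no graph; otherwise the two incidences are
    independent conditions on [h]. *)
Lemma card_on_plane2 p p' : p != p' ->
  (#|K| ^ 2 * #|[set h | on_plane p h && on_plane p' h]| <= #|{: 'cV[K]_d.+1}|)%N.
Proof.
move=> pp'; have [epp'|npp'] := eqVneq (lift_pt p) (lift_pt p').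
  rewrite (_ : [set _ | _]%SET = finset.set0) ?cards0 ?muln0 //.
  apply/finset.setP => h; rewrite !inE /on_plane -epp'; apply/negP => /andP[/eqP + /eqP].
  move=> -> e; case/eqP: pp'; apply/rowP => j.
  have := congr1 (fun M : 'rV[K]_d.+1 => M 0 j) epp'; rewrite !mxE.
  by case: eqP => [->|].
have [j jP] : exists j, lift_pt p 0 j != lift_pt p' 0 j.
  apply/existsP; apply: contraNT npp' => /existsPn H; apply/eqP/rowP => j.
  by apply/eqP/negPn; exact: H.
(* Moving [h] along [e0] fixes its value at [p] and changes its value at [p']; [e] rescales this
   change to unit speed. *)
pose e0 : 'cV[K]_d.+1 := delta_mx j 0 - (lift_pt p 0 j) *: delta_mx 0 0.
have me0 x : (lift_pt x *m e0) 0 0 = lift_pt x 0 j - lift_pt p 0 j.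
  rewrite mulmxBr -scalemxAr -!colE mxE; congr (_ + _); first by rewrite mxE.
  by rewrite !mxE eqxx mulr1.
pose c := lift_pt p' 0 j - lift_pt p 0 j.
have c0 : c != 0 by rewrite subr_eq0 eq_sym.
pose e := c^-1 *: e0.
have mp t h : (lift_pt p *m (h + t *: e)) 0 0 = (lift_pt p *m h) 0 0.
  rewrite mulmxDr -!scalemxAr mxE [X in _ + X]mxE [X in _ + _ * X]mxE me0.
  by rewrite subrr !mulr0 addr0.
have mp' t h : (lift_pt p' *m (h + t *: e)) 0 0 = (lift_pt p' *m h) 0 0 + t.
  rewrite mulmxDr -!scalemxAr mxE [X in _ + X]mxE [X in _ + _ * X]mxE me0.
  by rewrite mulVf // mulr1.
rewrite -(card_on_plane p) expnS expn1 -mulnA leq_mul2l; apply/orP; right.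
rewrite -(@card_level_set _ _ (fun t h => h + t *: e) [set h | on_plane p h]
  (fun h => (lift_pt p' *m h) 0 0) _ _ mp' (p' 0 0)).
- rewrite leq_mul2l; apply/orP; right; apply: subset_leq_card.
  by apply/fintype.subsetP => h; rewrite !inE.
- by move=> t h; rewrite scaleNr addrK.
- by move=> t h; rewrite !inE /on_plane mp.
Qed.

(* Second moment method for the number of points of [Z] on a random [h]. *)
Lemma missing_planes_card (Z : {set 'rV[K]_d.+1}) :
  (#|[set h | [forall p in Z, ~~ on_plane p h]]| * #|Z|
    <= #|K| * #|{: 'cV[K]_d.+1}|)%N.
Proof.
set W := [set h | _]; set N := #|{: 'cV[K]_d.+1}|; set q := #|K|; set m := #|Z|.
(* A rescaled centred indicator: [X p] has mean 0 over [h], and distinct points have nonpositive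
   covariance. *)
pose X p h : int := q%:Z * (on_plane p h)%:Z - 1.
have sumI (b : 'cV[K]_d.+1 -> bool) : \sum_h (b h)%:Z = #|[set h | b h]|%:Z.
  rewrite -sum1_card -natz natr_sum [RHS]big_mkcond /=.
  by apply: eq_bigr => h _; rewrite inE; case: (b h).
have cov p p' : \sum_h X p h * X p' h <= (if p == p' then q * N else 0)%N%:Z.
  have -> : \sum_h X p h * X p' h =
      (q ^ 2 * #|[set h | on_plane p h && on_plane p' h]|)%N%:Z
      - (q * #|[set h | on_plane p h]|)%N%:Z
      - (q * #|[set h | on_plane p' h]|)%N%:Z + N%:Z.
    rewrite !PoszM -!sumI !mulr_sumr -!sumrB /=.
    have -> : N%:Z = \sum_(h : 'cV[K]_d.+1) 1%:Z.
      by rewrite sumr_const; exact: (esym (natz _)).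
    rewrite -big_split /=; apply: eq_bigr => h _; rewrite /X.
    by case: (on_plane p h); case: (on_plane p' h); rewrite /=; lia.
  rewrite !card_on_plane; case: eqP => [->|/eqP /card_on_plane2]; last by lia.
  have -> : [set h | on_plane p' h && on_plane p' h] = [set h | on_plane p' h].
    by apply/finset.setP => h; rewrite !inE andbb.
  rewrite expnS expn1 -mulnA card_on_plane -/N.
  by have : (0 < q)%N by [apply/card_gt0P; exists 0]; lia.
have tot : \sum_h (\sum_(p in Z) X p h) ^+ 2 <= (m * (q * N))%N%:Z.
  under eq_bigr => h _ do rewrite expr2 mulr_suml.
  rewrite exchange_big /=.
  have -> : (m * (q * N))%N%:Z = \sum_(p in Z) (q * N)%N%:Z.
    by rewrite sumr_const PoszM mulrC -mulr_natr natz.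
  apply: ler_sum => p pZ.
  under eq_bigr => h _ do rewrite mulr_sumr.
  rewrite exchange_big /=.
  rewrite (bigD1 p) //= -[leRHS]addr0; apply: lerD.
    by have := cov p p; rewrite eqxx.
  apply: sumr_le0 => p' /andP[_ np]; have := cov p p'.
  by rewrite eq_sym (negPf np).
(* A plane that misses [Z] has every [X p h] equal to -1, so it contributes [m ^ 2]. *)
have low : (#|W| * m ^ 2)%N%:Z <= \sum_h (\sum_(p in Z) X p h) ^+ 2.
  rewrite (bigID [in W]) /= -[leLHS]addr0; apply: lerD; last first.
    by apply: sumr_ge0 => h _; exact: sqr_ge0.
  rewrite -sum_nat_const -natz natr_sum /=; apply: ler_sum => h.
  rewrite inE => /forall_inP hW.
  rewrite (eq_bigr (fun=> -1)); last first.
    by move=> p /hW /negPf; rewrite /X => ->; rewrite mulr0 sub0r.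
  by rewrite sumr_const mulNrn sqrrN natrX.
have := le_trans low tot; case: (posnP m) => [->|m0]; first by rewrite muln0.
by rewrite lez_nat expnS expn1 mulnCA leq_pmul2l.
Qed.

End Incidence.

(** * Greedy choice of planes *)

Lemma card_bigcup_seq (I : Type) (T : finType) (s : seq I) (A : I -> {set T}) :
  (#|(\bigcup_(i <- s) A i)%SET| <= \sum_(i <- s) #|A i|)%N.
Proof.
elim: s => [|i s IH]; first by rewrite !big_nil cards0.
rewrite !big_cons; apply: leq_trans (leq_card_setU _ _) _.
by rewrite leq_add2l.
Qed.

(** Each element already chosen forbids at most a fraction 1/q of [H], so [k] of them cannot exhaust
    [G]. *)
Lemma greedy_avoiding (H : finType) (G : {set H}) (top : H -> {set H}) (q k : nat) :
  (forall h, q * #|top h| <= #|H|)%N -> (k * #|H| < q * #|G|)%N ->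
  exists hs : 'I_k.+1 -> H, (forall i, hs i \in G) /\
    forall i j : 'I_k.+1, (i < j)%N -> hs j \notin top (hs i).
Proof.
move=> topP kG.
suff [s [/eqP ss sG sP]] : exists s : seq H, [/\ size s == k.+1, all [in G] s &
    pairwise (fun x y => y \notin top x) s].
  have [h0 _] : exists h, h \in G.
    by apply/card_gt0P; rewrite lt0n; apply: contraTneq kG => ->; rewrite muln0.
  exists (fun i => nth h0 s i); split=> [i|i j ij].
    by apply: (allP sG); rewrite mem_nth // ss.
  by apply/(pairwiseP h0 sP) => //; rewrite inE ss.
have : (k.+1 <= k.+1)%N by [].
elim: {1 3}(k.+1) => [|l IH] lk; first by exists [::].
have {IH} [s [/eqP ss sG sP]] := IH (ltnW lk).
have [h] : exists h, h \in G :\: \bigcup_(x <- s) top x.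
  apply/card_gt0P; rewrite cardsD subn_gt0.
  apply: (@leq_ltn_trans #|\bigcup_(x <- s) top x|).
    by apply/subset_leq_card/finset.subsetIr.
  have q0 : (0 < q)%N by case: q kG {topP}.
  rewrite -(ltn_pmul2l q0); apply: leq_ltn_trans kG.
  apply: (@leq_trans (\sum_(x <- s) q * #|top x|)%N).
    rewrite -big_distrr /= leq_mul2l; apply/orP; right.
    exact: card_bigcup_seq.
  apply: (@leq_trans (\sum_(x <- s) #|H|)); first exact: leq_sum.
  by rewrite big_const_seq count_predT ss iter_addn_0 mulnC leq_mul2r -ltnS lk orbT.
rewrite inE => /andP[hs hG]; exists (rcons s h); split.
- by rewrite size_rcons ss.
- by rewrite all_rcons hG.
rewrite pairwise_rcons sP andbT; apply/allP => x xs; apply: contra hs => hx.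
by rewrite (big_rem x xs) /= inE hx.
Qed.

Local Open Scope classical_set_scope.
Local Open Scope ring_scope.

(** * Weights of faces and the continuous map they define *)

Lemma continuous_max0 (R : realType) (X : topologicalType) (g : X -> R) (y : X) :
  {for y, continuous g} -> {for y, continuous (fun z => Num.max 0 (g z))}.
Proof. by move=> gc; apply: continuous_max; [exact: cvg_cst|exact: gc]. Qed.

Section Weights.
Variables (R : realType) (T : finType).
Implicit Types (A B : {set T}) (x : T -> R).

(* Substitute for the coordinate of [x] at the barycenter of [A] in the first
   barycentric subdivision: the two have the same zeros, but this one is a
   product of continuous functions. *)
Definition weight A x : R :=
  (\prod_(v in A) Num.max 0 (x v)) *
  \prod_(p : T * T | (p.1 \in A) && (p.2 \notin A)) Num.max 0 (x p.1 - x p.2).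

Lemma weight_ge0 A x : 0 <= weight A x.
Proof. by apply: mulr_ge0; apply: prodr_ge0 => i _; rewrite le_max lexx. Qed.

Lemma weight_neq0P A x : reflect
  ((forall v, v \in A -> 0 < x v) /\
   (forall v w, v \in A -> w \notin A -> x w < x v))
  (weight A x != 0).
Proof.
have max0 (a : R) : (Num.max 0 a != 0) = (0 < a).
  by rewrite /Order.max; case: ifPn => [a0|_]; rewrite ?eqxx // gt_eqF.
rewrite mulf_eq0 negb_or; apply: (iffP andP) => -[].
  move=> /prodf_neq0 H1 /prodf_neq0 H2; split=> [v /H1|v w vA wA].
    by rewrite max0.
  by have := H2 (v, w); rewrite /= vA wA max0 subr_gt0 => /(_ isT).
move=> H1 H2; split.
  by apply/prodf_neq0 => v /H1; rewrite max0.
by apply/prodf_neq0 => -[v w] /= /andP[vA wA]; rewrite max0 subr_gt0 H2.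
Qed.

Lemma continuous_weight (X : topologicalType) (g : X -> T -> R) (y : X) A :
  (forall v, {for y, continuous (g^~ v)}) ->
  {for y, continuous (fun z => weight A (g z))}.
Proof.
move=> gc; rewrite /weight; apply: continuousM.
  apply: (cvg_big (@mul_continuous R)) => v _.
  by apply: continuous_max0; exact: gc.
apply: (cvg_big (@mul_continuous R)) => -[v w] _.
apply: (@continuous_max0 R X (fun z => g z v - g z w)).
by apply: cvgB; exact: gc.
Qed.

(** Sets of nonzero weight are superlevel sets of [x], hence nested. *)
Lemma weight_chain A B x :
  weight A x != 0 -> weight B x != 0 -> (A \subset B) || (B \subset A).
Proof.
move=> /weight_neq0P[_ xA] /weight_neq0P[_ xB].
apply/negPn/negP; rewrite negb_or => /andP[/subsetPn[v vA vB] /subsetPn[w wB wA]].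
by have := lt_trans (xA _ _ vA wA) (xB _ _ wB vB); rewrite ltxx.
Qed.

Lemma weight_top x (v : T) : 0 < x v -> (forall w, x w <= x v) ->
  weight [set w | x w == x v]%SET x != 0.
Proof.
move=> xv0 xmax; apply/weight_neq0P; split=> [w|w w']; rewrite !inE.
  by move/eqP->.
by move=> /eqP-> w'v; rewrite lt_neqAle w'v xmax.
Qed.

(** A vertex of maximal coordinate thus lies in every member of the flag, so the planes through this
    single vertex contain all the planes through any member. *)
Lemma weight_max A x (v : T) : (forall w, x w <= x v) -> A != finset.set0 ->
  weight A x != 0 -> v \in A.
Proof.
move=> xmax /finset.set0Pn[w wA] /weight_neq0P[_ xA]; apply/negPn/negP => vA.
by have := lt_le_trans (xA _ _ wA vA) (xmax w); rewrite ltxx.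
Qed.

Definition weights x : R := \sum_(A : {set T} | A != finset.set0) weight A x.

Lemma gsimplex_max (s : {set T}) x : @gsimplex R T s x ->
  exists2 v, 0 < x v & forall w, x w <= x v.
Proof.
move=> [x0 x1 _].
have [v0 v0P|xz] := pickP (fun v => x v != 0); last first.
  move: x1; rewrite big1 => [/eqP|v _]; first by rewrite eq_sym oner_eq0.
  by apply/eqP; move: (xz v) => /= /negbFE.
case: (@Order.TotalTheory.arg_maxP _ R T v0 predT (x : T -> R) isT) => v _ vmax.
exists v; last by move=> w; exact: vmax.
by apply: lt_le_trans (vmax v0 isT); rewrite lt_neqAle eq_sym v0P x0.
Qed.

Lemma weights_neq0 (s : {set T}) x : @gsimplex R T s x -> weights x != 0.
Proof.
move=> /gsimplex_max[v xv xmax].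
have tA := weight_top xv xmax.
rewrite psumr_neq0; last by move=> A _; exact: weight_ge0.
apply/hasP; exists [set w | x w == x v]%SET; first by rewrite mem_index_enum.
rewrite lt0r tA weight_ge0 !andbT.
by apply/finset.set0Pn; exists v; rewrite inE.
Qed.

(** On the realization [weights x] is nonzero and the coefficients sum to 1; continuity is claimed
    only there. *)
Definition weighted_map (d : nat) (y : {set T} -> 'rV[R]_d) x : 'rV[R]_d :=
  \sum_(A : {set T} | A != finset.set0) (weight A x / weights x) *: y A.

Lemma continuous_weighted_map (X : topologicalType) (g : X -> T -> R) (y : X) d
    (p : {set T} -> 'rV[R]_d.+1) :
  (forall v, {for y, continuous (g^~ v)}) -> weights (g y) != 0 ->
  {for y, continuous (fun z => weighted_map p (g z))}.
Proof.
move=> gc w0; rewrite /weighted_map.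
have sumc : weights (g z) @[z --> y] --> weights (g y).
  by apply: (cvg_big (@add_continuous R)) => A _; exact: continuous_weight.
apply: (cvg_big (@add_continuous 'rV[R]_d.+1)) => A _.
apply: cvgZr_tmp; apply: cvgM; first exact: continuous_weight.
by apply: cvgV.
Qed.

Lemma within_continuous_weighted_map d (p : {set T} -> 'rV[R]_d.+1)
    (C : {set {set T}}) :
  {within realization C, continuous (weighted_map p : {ptws T -> R} -> 'rV[R]_d.+1)}.
Proof.
apply: continuous_in_subspaceT => x /[!inE] -[s _ xs].
apply: (@continuous_weighted_map {ptws T -> R} (fun z : {ptws T -> R} => z));
  last exact: weights_neq0 xs.
move=> v; exact: (@proj_continuous _ (fun=> R)).
Qed.

End Weights.

(** * Flags of flats inside a plane *)

Section FlagMap.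
Variables (R : realType) (K : finFieldType) (d : nat) (T : finType).
Variable pt : T -> 'rV[K]_d.+1.
Implicit Types (A B s : {set T}) (h : 'cV[K]_d.+1).

Definition planes_through A : {set 'cV[K]_d.+1} :=
  [set h | [forall v in A, on_plane (pt v) h]]%SET.

(** For nonempty [A], one more than the affine dimension of the points projected along coordinate 0;
    this projection is injective on the graph of any [h]. *)
Definition span_rank A : nat := \rank (\sum_(v in A) <<lift_pt (pt v)>>)%MS.

Lemma planes_through_sub A B :
  A \subset B -> planes_through B \subset planes_through A.
Proof.
move=> AB; apply/fintype.subsetP => h; rewrite !inE => /forall_inP hB.
by apply/forall_inP => v /(fintype.subsetP AB); exact: hB.
Qed.

Lemma span_rank_gt0 A : A != finset.set0 -> (0 < span_rank A)%N.
Proof.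
move=> /finset.set0Pn[v vA]; apply: (@leq_trans (\rank (lift_pt (pt v)))).
  rewrite rank_rV; case: eqP => // /rowP/(_ 0); rewrite !mxE eqxx => /eqP.
  by rewrite oner_eq0.
by apply: mxrankS; apply: (sumsmx_sup v) => //; rewrite genmxE.
Qed.

(* The planes of the family containing [A] form a coset of the annihilator of
   the span of the [lift_pt (pt v)], so the span determines them once one
   plane is known. *)
Lemma planes_through_eq A B h : A \subset B -> span_rank A = span_rank B ->
  h \in planes_through B -> planes_through A = planes_through B.
Proof.
move=> AB rAB hB; apply/eqP; rewrite finset.eqEsubset.
apply/andP; split; last exact: planes_through_sub.
have hA := fintype.subsetP (planes_through_sub AB) _ hB.
apply/fintype.subsetP => h' h'A; rewrite inE; apply/forall_inP => v vB.
have sAB : (\sum_(v in A) <<lift_pt (pt v)>> <= \sum_(v in B) <<lift_pt (pt v)>>)%MS.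
  apply/sumsmx_subP => w wA; apply: (sumsmx_sup w) => //.
  exact: (fintype.subsetP AB).
have kerA : (\sum_(v in A) <<lift_pt (pt v)>> <= kermx (h' - h))%MS.
  apply/sumsmx_subP => w wA; rewrite genmxE; apply/sub_kermxP.
  apply/rowP => i; rewrite !ord1 mulmxBr mxE [X in _ + X]mxE.
  move: hA h'A; rewrite !inE => /forall_inP/(_ _ wA)/eqP -> /forall_inP/(_ _ wA)/eqP ->.
  by rewrite subrr mxE.
have sBA : (\sum_(v in B) <<lift_pt (pt v)>> <= \sum_(v in A) <<lift_pt (pt v)>>)%MS.
  by rewrite -(geq_leqif (mxrank_leqif_sup sAB)) -/(span_rank B) -rAB.
have : (lift_pt (pt v) <= kermx (h' - h))%MS.
  apply: submx_trans (submx_trans sBA kerA).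
  by apply: (sumsmx_sup v) => //; rewrite genmxE.
move/sub_kermxP/rowP/(_ 0); rewrite mulmxBr mxE [X in _ + X]mxE [RHS]mxE => /eqP.
rewrite subr_eq0 /on_plane => /eqP->.
by move: hB; rewrite inE => /forall_inP/(_ _ vB).
Qed.

Definition flat_rank A : 'I_d.+1 := inord (span_rank A).-1.

Lemma flat_rankE A : A != finset.set0 -> (flat_rank A).+1 = span_rank A.
Proof.
move=> A0; rewrite inordK prednK ?span_rank_gt0 //.
by apply: leq_trans (rank_leq_col _) _.
Qed.

(** Encoding a flat by the planes through it makes flags comparable: a flat shared by the flags of
    two planes is a set containing both planes. *)
Definition flat_label (I : finType) A : 'I_d.+1 * ({set 'cV[K]_d.+1} + I) :=
  (flat_rank A, inl (planes_through A)).

(* [phi k] is the member of rank [k.+1] of the flag supporting [x]; ranks which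
   the flag skips get a dummy vertex [inr i], with coefficient 0, so that every
   simplex has exactly [d.+1] vertices. *)
Lemma weighted_map_flag (I : finType) s h (x : T -> R)
    (w : 'I_d.+1 * ({set 'cV[K]_d.+1} + I) -> 'rV[R]_d.+1) :
  h \in planes_through s -> @gsimplex R T s x ->
  exists (top : {set 'cV[K]_d.+1}) (phi : 'I_d.+1 -> option {set 'cV[K]_d.+1})
      (a : 'I_d.+1 -> R),
    [/\ (#|K| * #|top| = #|{: 'cV[K]_d.+1}|)%N,
        forall k p, phi k = Some p -> h \in p /\ p \subset top,
        \sum_k a k = 1 &
        forall i, weighted_map (fun A => w (flat_label I A)) x =
          \sum_k a k *: w (k, if phi k is Some p then inl p else inr i)].
Proof.
move=> hs xs; have W0 := weights_neq0 xs.
have [v xv xmax] := gsimplex_max xs.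
pose C A := (A != finset.set0) && (weight A x != 0).
have Ch A : C A -> h \in planes_through A.
  move=> /andP[_ /weight_neq0P[x0 _]]; apply: (fintype.subsetP (planes_through_sub _)) hs.
  apply/fintype.subsetP => u /x0 xu; apply/negPn/negP => us.
  by case: xs => _ _ /(_ _ us) e; rewrite e ltxx in xu.
pose phi k := omap planes_through [pick A | C A && (flat_rank A == k)].
pose a k := \sum_(A : {set T} | (A != finset.set0) && (flat_rank A == k))
  weight A x / weights x.
(* Here [v] has maximal coordinate, so [top] bounds the whole flag and still has density 1/q. *)
exists (planes_through [set v]%SET), phi, a; split.
- rewrite -(card_on_plane (pt v)); congr (_ * _)%N; apply: eq_card => h'.
  rewrite !inE; apply/forall_inP/idP => [|e u]; first by apply; rewrite inE.
  by rewrite inE => /eqP->.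
- move=> k p; rewrite /phi; case: pickP => //= A /andP[CA _] [<-]; split; first exact: Ch.
  apply: planes_through_sub; rewrite finset.sub1set; case/andP: CA => A0 wA.
  exact: (weight_max xmax A0 wA).
- rewrite -(@partition_big _ _ _ _ _ _ _ (fun A => flat_rank A) predT) //=.
  by rewrite -mulr_suml mulfV.
move=> i; rewrite /weighted_map (partition_big flat_rank predT) //=.
apply: eq_bigr => k _; rewrite /a scaler_suml; apply: eq_bigr => A /andP[A0 /eqP rA].
have [->|wA] := eqVneq (weight A x) 0; first by rewrite mul0r !scale0r.
congr (_ *: w _); rewrite /flat_label rA; congr pair; rewrite /phi.
have CA : C A by rewrite /C A0.
case: pickP => [B /andP[CB /eqP rB]|/(_ A)] /=; last by rewrite CA rA eqxx.
(* [A] and [B] are nested and of equal rank, so they span the same flat and the choice made by [phi]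
   is immaterial. *)
congr inl; have eAB : span_rank A = span_rank B.
  by rewrite -!flat_rankE ?rA ?rB //; case/andP: CB.
have /orP[AB|BA] := weight_chain wA (proj2 (andP CB)).
  exact: planes_through_eq AB eAB (Ch _ CB).
exact/esym/(planes_through_eq BA (esym eAB) (Ch _ CA)).
Qed.

End FlagMap.

(** * Bounding the overlap *)

(** Union bound: each [Z i] is missed by at most a fraction q/m of the planes, so fewer than half
    miss some [Z i]. *)
Lemma missing_some_card (K : finFieldType) (d m : nat) (I : finType)
    (Z : I -> {set 'rV[K]_d.+1}) :
  (forall i, #|Z i| = m) -> (2 * #|I| * #|K| < m)%N ->
  (#|{: 'cV[K]_d.+1}| <
    2 * #|[set h : 'cV[K]_d.+1 | [forall i, exists p in Z i, on_plane p h]]%SET|)%N.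
Proof.
move=> Zm mbig; set N := #|{: _}|; set G := finset _.
have N0 : (0 < N)%N by apply/card_gt0P; exists 0.
have := cardsC G; rewrite -/N => GC.
have : (#|~: G| * m <= #|I| * (#|K| * N))%N.
  pose W i : {set 'cV[K]_d.+1} := [set h | [forall p in Z i, ~~ on_plane p h]]%SET.
  apply: (@leq_trans (\sum_i #|W i| * m)%N).
    rewrite -big_distrl leq_mul2r; apply/orP; right.
    apply: (@leq_trans #|(\bigcup_i W i)%SET|); last exact: card_bigcup_seq.
    apply: subset_leq_card; apply/fintype.subsetP => h; rewrite !inE => /forallPn[i].
    rewrite negb_exists_in => hi; apply/finset.bigcupP; exists i => //; rewrite inE //.
  rewrite -sum_nat_const; apply: leq_sum => i _.
  by rewrite -(Zm i) missing_planes_card.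
case: (posnP #|~: G|) => [e0|G0]; first by lia.
move=> le; have : (#|~: G| * (2 * #|I| * #|K|) < #|I| * (#|K| * N))%N.
  by apply: leq_trans le; rewrite ltn_pmul2l.
nia.
Qed.

Lemma overlap_bound (R : realType) (K : finFieldType) (d n : nat) :
  (n <= #|K| ^ d.+1)%N -> (2 * d.+1 <= #|K|)%N ->
  exists f : {ptws ('I_d.+2 * 'I_n)%type -> R} -> 'rV[R]_d.+1,
    {within realization (join (@parts d.+2 n)), continuous f} /\
    forall m, overlap (@parts d.+2 n) f m -> (m <= 2 * d.+2 * #|K|)%N.
Proof.
move=> nK dK.
have [iota iota_inj] : exists g : 'I_n -> 'rV[K]_d.+1, injective g.
  have nK' : (n <= #|{: 'rV[K]_d.+1}|)%N by rewrite card_mx mul1n.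
  by exists (fun a => enum_val (widen_ord nK' a)) => a b /enum_val_inj[] /val_inj.
pose pt (v : 'I_d.+2 * 'I_n) := iota v.2.
have [w wP] := affine_general_position R d.+1
  ('I_d.+1 * ({set 'cV[K]_d.+1} + 'I_d.+2))%type.
exists (weighted_map (fun A => w (flat_label pt 'I_d.+2 A))).
split; first exact: within_continuous_weighted_map.
move=> m [Z [ZP [u uP]]]; rewrite leqNgt; apply/negP => mbig.
pose G := [set h : 'cV[K]_d.+1 | [forall i, exists p in pt @: Z i, on_plane p h]]%SET.
have Gbig : (#|{: 'cV[K]_d.+1}| < 2 * #|G|)%N.
  apply: (@missing_some_card _ _ m); last by rewrite card_ord.
  move=> i; have [Zi <-] := ZP i; apply: card_in_imset => -[i1 a1] [i2 a2].
  move=> /(fintype.subsetP Zi) + /(fintype.subsetP Zi); rewrite !inE /= => /eqP-> /eqP->.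
  by rewrite /pt /= => /iota_inj->.
(* Stated for every [h], with a dummy value outside [G], so that choice yields a function [t]. *)
have flagP h : exists t : {set 'cV[K]_d.+1} * ('I_d.+1 -> option {set 'cV[K]_d.+1})
      * ('I_d.+1 -> R), h \in G ->
    [/\ (#|K| * #|t.1.1| = #|{: 'cV[K]_d.+1}|)%N,
        forall k p, t.1.2 k = Some p -> h \in p /\ p \subset t.1.1,
        \sum_k t.2 k = 1 &
        forall i, u =
          \sum_k t.2 k *: w (k, if t.1.2 k is Some p then inl p else inr i)].
  have [hG|] := boolP (h \in G); last by exists (finset.set0, fun=> None, fun=> 0).
  have zex i : exists v, v \in Z i /\ on_plane (pt v) h.
    move: hG; rewrite inE => /forallP/(_ i)/exists_inP[_ /imsetP[v vZ ->] hv].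
    by exists v.
  have [z zP] := boolp.choice zex.
  have [x xs xu] := uP z (fun i => (zP i).1).
  have hs : h \in planes_through pt [set z i | i in 'I_d.+2]%SET.
    by rewrite inE; apply/forall_inP => _ /imsetP[i _ ->]; exact: (zP i).2.
  have [top [phi [a [H1 H2 H3 H4]]]] := weighted_map_flag w hs xs.
  by exists (top, phi, a) => _; split => //= i; rewrite -xu (H4 i).
have [t tP] := boolp.choice flagP.
have [||hs [hsG hsP]] := @greedy_avoiding _ G
    (fun h => if h \in G then (t h).1.1 else finset.set0) #|K| d.+1.
- by move=> h; case: ifP => [/tP[->]|_] //; rewrite cards0 muln0.
- apply: (@leq_trans (d.+1 * (2 * #|G|))); first by rewrite ltn_pmul2l.
  by rewrite mulnA (mulnC d.+1) leq_mul2r dK orbT.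
pose F i k := (k, if (t (hs i)).1.2 k is Some p then inl p else inr i)
  : ('I_d.+1 * ({set 'cV[K]_d.+1} + 'I_d.+2))%type.
apply: (wP F _ u (fun i => (t (hs i)).2)).
(* Labels include the rank, and dummies the index [i]. A flat shared by [i < j] would contain [hs j]
   and lie in the [top] of [hs i], against the greedy choice. *)
- move=> [i k] [j l] /= [<-] {l}.
  have := hsP i j; have := hsP j i; rewrite !hsG.
  case Ei: ((t (hs i)).1.2 k) => [p|];
    case Ej: ((t (hs j)).1.2 k) => [p'|] //; last first.
    by move=> _ _ [->].
  have [_ /(_ _ _ Ei)[hip pi] _ _] := tP _ (hsG i).
  have [_ /(_ _ _ Ej)[hjp pj] _ _] := tP _ (hsG j).
  move=> ji ij [e]; case: (ltngtP i j) => [/ij/negP[]|/ji/negP[]|/val_inj-> //].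
    by apply: (fintype.subsetP pi); rewrite e.
  by apply: (fintype.subsetP pj); rewrite -e.
- by move=> i; have [] := tP _ (hsG i).
- by move=> i; have [_ _ _] := tP _ (hsG i); apply.
Qed.

(** * Choice of the field and the final estimate *)

Lemma pach_number_le (R : realType) (K : finFieldType) (d n : nat) :
  (n <= #|K| ^ d.+1)%N -> (2 * d.+1 <= #|K|)%N ->
  (pach_number R d.+1 n <= 2 * d.+2 * #|K|)%N.
Proof.
move=> nK dK; have [f [fc fP]] := overlap_bound R nK dK.
rewrite /pach_number; case: ex_minnP => t _ /(_ (tau (@parts d.+2 n) f)) tmin.
apply: leq_trans (tmin _) _; first by apply/asboolP; exists f.
by apply/bigmax_leqP => m /asboolP /fP.
Qed.

(** Take the least power of two whose power [d.+1] reaches [n]. It is at most twice the root of [n],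
    and the lower bound on [n] rules out exponent 0. *)
Lemma exists_power2 (d n : nat) : ((2 * d.+1) ^ d.+1 <= n)%N ->
  exists k, [/\ (n <= (2 ^ k.+1) ^ d.+1)%N, (2 * d.+1 <= 2 ^ k.+1)%N &
    ((2 ^ k) ^ d.+1 <= n)%N].
Proof.
move=> dn; have exk : exists k, (n <= (2 ^ k) ^ d.+1)%N.
  exists n; apply: leq_trans (ltnW (ltn_expl n (ltnSn 1))) _.
  by rewrite expnS leq_pmulr // !expn_gt0.
case: (ex_minnP exk) => -[|k] nk kmin.
  have le : (2 * d.+1 <= (2 * d.+1) ^ d.+1)%N.
    by rewrite [leqRHS]expnS leq_pmulr // expn_gt0.
  by have := leq_trans le (leq_trans dn nk); rewrite expn0 exp1n; lia.
exists k; split => //.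
  by rewrite -(@leq_exp2r _ _ d.+1) //; exact: leq_trans nk.
by rewrite leqNgt; apply/negP => /ltnW /kmin; rewrite ltnn.
Qed.

Theorem theorem1p2 (R : realType) :
  exists c2 : nat -> R,
    [/\ forall d : nat, (1 <= d)%N -> 0 < c2 d,
        c2 =O_\oo (fun d : nat => d%:R : R) &
        forall d n : nat, (1 <= d)%N -> ((2 * d) ^ d <= n)%N ->
          (pach_number R d n)%:R <= c2 d * (n%:R `^ (d%:R^-1))].
Proof.
(* The overlap bound gives [2 * d.+1 * q], and rounding up to a power of two costs a factor 2. *)
exists (fun d => (4 * d.+1)%:R); split.
- by move=> d _; rewrite ltr0n.
- apply/eqOP; near=> k; near=> d.
  have d0 : (0 < d)%N by near: d; exists 1%N.
  rewrite !ger0_norm ?ler0n //; apply: (@le_trans _ _ (8 * d%:R)).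
    by rewrite -natrM ler_nat; lia.
  by apply: ler_wpM2r; rewrite ?ler0n //; near: k; exact: nbhs_pinfty_ge.
case=> // d n _ dn; have [k [nk dk kn]] := exists_power2 dn.
have [K _ Kcard] := @PrimePowerField 2 k.+1 isT isT.
have := @pach_number_le R K d n; rewrite Kcard => /(_ nk dk) le.
apply: (@le_trans _ _ ((2 * d.+2 * 2 ^ k.+1)%:R)); first by rewrite ler_nat.
have -> : (2 * d.+2 * 2 ^ k.+1 = 4 * d.+2 * 2 ^ k)%N by rewrite expnS; lia.
rewrite natrM ler_wpM2l ?ler0n //.
have -> : (2 ^ k)%:R = (((2 ^ k) ^ d.+1)%:R : R) `^ (d.+1%:R^-1).
  by rewrite [in RHS]natrX -powR_mulrn ?ler0n // -powRrM mulfV ?pnatr_eq0 // powRr1 //.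
apply: ge0_ler_powR; rewrite ?invr_ge0 ?ler0n ?nnegrE ?ler_nat //.
Unshelve. all: by end_near.
Qed.
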